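(* Let $T=(T_1,\dots,T_n)$ be a weighted shift on $\mathcal{H}_n$ with weights $\Lambda=\{\lambda_{i,w}\}$ and weight function $W$, and suppose that $$\sup_{1\le i\le n,\ w\in\mathbb{F}_n^+} W(i,w)\,W(e,w)^{-1}<\infty .$$ If the set of eigenvalues for $\mathfrak{L}_\Lambda^*$ contains a nonempty open set $\mathbb{U}$ in $\mathbb{C}^n$, then $\mathfrak{L}_\Lambda$ is reflexive.
   Context: Let $n\ge 2$ and let $\mathbb{F}_n^+$ be the unital free semigroup on $n$ noncommuting letters $\{1,\dots,n\}$, with unit $e$ (the empty word). Fock space is $\mathcal{H}_n=\ell^2(\mathbb{F}_n^+)$ with orthonormal basis $\{\xi_w: w\in\mathbb{F}_n^+\}$. A weighted shift on $\mathcal{H}_n$ with weights $\Lambda=\{\lambda_{i,w}: 1\le i\le n,\ w\in\mathbb{F}_n^+\}$ is an $n$-tuple $T=(T_1,\dots,T_n)$ of bounded operators on $\mathcal{H}_n$ with $T_i\xi_w=\lambda_{i,w}\xi_{iw}$ for all $i,w$; throughout, all $\lambda_{i,w}>0$ (and $\sup_{i,w}\lambda_{i,w}<\infty$ by boundedness). $\mathfrak{L}_\Lambda$ denotes the unital weak-operator-topology (WOT) closed algebra generated by $\{T_1,\dots,T_n\}$. The weight function $W:\mathbb{F}_n^+\times\mathbb{F}_n^+\to\mathbb{R}_+$ is $W(u,e)=1$ and $W(u,w)=\lambda_{i_1,u}\lambda_{i_2,i_1u}\cdots\lambda_{i_k,i_{k-1}\cdots i_1u}$ for $w=i_k\cdots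 i_1$. A point $(\lambda_1,\dots,\lambda_n)\in\mathbb{C}^n$ is an eigenvalue for $\mathfrak{L}_\Lambda^*$ if there is a nonzero $\xi\in\mathcal{H}_n$ with $T_i^*\xi=\lambda_i\xi$ for $1\le i\le n$. An operator algebra $\mathfrak{A}$ is reflexive if $\mathfrak{A}=\operatorname{Alg}\operatorname{Lat}\mathfrak{A}$, where $\operatorname{Lat}\mathfrak{A}$ is the lattice of closed subspaces invariant under every member of $\mathfrak{A}$, and $\operatorname{Alg}\mathcal{L}$ is the algebra of all bounded operators leaving every subspace in $\mathcal{L}$ invariant. *)

(* Defs.v *)
From HB Require Import structures.
From mathcomp Require Import all_boot all_order all_algebra.
From mathcomp Require Import all_classical all_reals all_analysis.
From mathcomp Require Import complex.
From mathcomp Require Import ring lra.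

Set Implicit Arguments.
Unset Strict Implicit.
Unset Printing Implicit Defensive.

Import Order.TTheory GRing.Theory Num.Theory.
Import numFieldNormedType.Exports.

Local Open Scope classical_set_scope.
Local Open Scope complex_scope.
Local Open Scope ring_scope.

Lemma esumZl (R : realType) (I : choiceType) (c : R) (a : I -> R) :
  0 <= c -> (forall i, 0 <= a i) ->
  (\esum_(i in [set: I]) (c * a i)%:E = c%:E * \esum_(i in [set: I]) (a i)%:E)%E.
Proof.
move=> c0 a0.
have le_scale (d : R) (b : I -> R) : 0 <= d -> (forall i, 0 <= b i) ->
    (\esum_(i in [set: I]) (d * b i)%:E <= d%:E * \esum_(i in [set: I]) (b i)%:E)%E.
  move=> d0 b0; apply: ge_ereal_sup => _ [X XI <-].
  rewrite (eq_fsbigr (fun i => (d%:E * (b i)%:E)%E)) => [|i _]; last by rewrite EFinM.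
  rewrite -ge0_mule_fsumr => [|i]; last by rewrite lee_fin.
  by rewrite lee_wpmul2l ?lee_fin//; apply: esum_ge; exists X.
apply/eqP; rewrite eq_le le_scale//=.
have [->|cn0] := eqVneq c 0.
  by rewrite mul0e; apply: esum_ge0 => i _; rewrite mul0r.
have cp : 0 < c by rewrite lt_neqAle eq_sym cn0.
rewrite -lee_pdivlMl//.
have := @le_scale c^-1 (fun i => c * a i); rewrite invr_ge0.
under eq_esum do rewrite mulKf//.
by apply => // i; rewrite mulr_ge0.
Qed.

Section SquareSummable.
Context {R : realType} {I : choiceType}.
Implicit Types f g : I -> R[i].

Definition sqnorm f : \bar R :=
  \esum_(i in [set: I]) (Normc.normc (f i) ^+ 2)%:E.

Definition square_summable : {pred I -> R[i]} :=
  [pred f | (sqnorm f < +oo)%E].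

Lemma sqnorm_ge0 f : (0 <= sqnorm f)%E.
Proof. by apply: esum_ge0 => i _; rewrite lee_fin sqr_ge0. Qed.

Lemma sqnormZ (c : R[i]) f :
  (sqnorm (c *: f) = (Normc.normc c ^+ 2)%:E * sqnorm f)%E.
Proof.
rewrite /sqnorm -esumZl ?sqr_ge0// => [|i]; last by rewrite sqr_ge0.
by apply: eq_esum => i _; rewrite -exprMn -Normc.normcM.
Qed.

Lemma normc_ge0 (z : R[i]) : 0 <= Normc.normc z.
Proof. by case: z => a b; exact: sqrtr_ge0. Qed.

(* A weighted form of |z + w|^2 <= (|z| + |w|)^2, giving the triangle
   inequality on optimizing the weights. *)
Lemma sqnormD f g (a b : R) : 0 < a -> 0 < b ->
  (sqnorm (f + g)%R <= ((a + b) / a)%:E * sqnorm f + ((a + b) / b)%:E * sqnorm g)%E.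
Proof.
move=> a0 b0.
rewrite /sqnorm -!esumZl//; first last.
- by move=> i; rewrite sqr_ge0.
- by rewrite divr_ge0 ?addr_ge0 ?ltW.
- by move=> i; rewrite sqr_ge0.
- by rewrite divr_ge0 ?addr_ge0 ?ltW.
rewrite -esumD => [|i _|i _]; last 2 first.
- by rewrite lee_fin mulr_ge0 ?sqr_ge0 ?divr_ge0 ?addr_ge0 ?ltW.
- by rewrite lee_fin mulr_ge0 ?sqr_ge0 ?divr_ge0 ?addr_ge0 ?ltW.
apply: le_esum => i _; rewrite -EFinD lee_fin.
have := le_normcD (f i) (g i); rewrite -[(f + g) i]/(f i + g i).
have := normc_ge0 (f i + g i).
move: (Normc.normc (f i + g i)) => s.
move: (Normc.normc (f i)) (Normc.normc (g i)) => p q s0 spq.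
apply: (@le_trans _ _ ((p + q) ^+ 2)); first by rewrite ler_sqr ?nnegrE// (le_trans s0).
rewrite -subr_ge0.
have -> : (a + b) / a * p ^+ 2 + (a + b) / b * q ^+ 2 - (p + q) ^+ 2 =
    (b * p - a * q) ^+ 2 / (a * b) by field; rewrite !gt_eqF.
by rewrite divr_ge0 ?sqr_ge0 ?mulr_ge0 ?ltW.
Qed.

Lemma sqnorm0 : sqnorm 0 = 0%E.
Proof. by apply: esum1 => i _; rewrite [_ i]/(0 : R[i]) Normc.normc0 expr0n. Qed.

Lemma square_summable_submod : GRing.submod_closed square_summable.
Proof.
split; first by rewrite inE sqnorm0.
move=> c f g; rewrite !inE => fs gs.
apply: le_lt_trans (sqnormD _ _ ltr01 ltr01) _.
by rewrite lte_add_pinfty// lte_mul_pinfty ?lee_fin ?sqnorm_ge0 ?divr_ge0//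
  sqnormZ lte_mul_pinfty ?lee_fin ?sqr_ge0.
Qed.

HB.instance Definition _ :=
  GRing.isSubmodClosed.Build R[i] (I -> R[i]) square_summable
    square_summable_submod.

End SquareSummable.

Record ell2 (R : realType) (I : choiceType) := Ell2 {
  ell2_val :> I -> R[i];
  ell2_summable : ell2_val \in square_summable }.

HB.instance Definition _ R I := [isSub for @ell2_val R I].
HB.instance Definition _ R I := [Choice of ell2 R I by <:].
HB.instance Definition _ R I := [SubChoice_isSubLmodule of ell2 R I by <:].

Section Ell2Norm.
Context {R : realType} {I : choiceType}.
Implicit Types x y : ell2 R I.

Definition ell2_norm x : R := Num.sqrt (fine (sqnorm x)).

Lemma sqnorm_fin x : sqnorm x \is a fin_num.
Proof. by rewrite ge0_fin_numE ?sqnorm_ge0//; case: x. Qed.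

Lemma ell2_norm_ge0 x : 0 <= ell2_norm x. Proof. exact: sqrtr_ge0. Qed.

Lemma sqr_ell2_norm x : (ell2_norm x ^+ 2)%:E = sqnorm x.
Proof. by rewrite sqr_sqrtr ?fine_ge0 ?sqnorm_ge0// fineK ?sqnorm_fin. Qed.

Lemma ell2_norm0_eq0 x : ell2_norm x = 0 -> x = 0.
Proof.
move=> x0; apply/val_inj/funext => i; apply: Normc.eq0_normc; apply/eqP.
rewrite -sqrf_eq0 eq_le sqr_ge0 andbT -lee_fin.
have -> : 0%:E = sqnorm x by rewrite -sqr_ell2_norm x0 expr0n.
apply: esum_ge; exists [set i]; first by split => //; exact: finite_set1.
by rewrite fsbig_set1.
Qed.

Lemma ell2_normZ (c : R[i]) x : ell2_norm (c *: x) = Normc.normc c * ell2_norm x.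
Proof.
apply/eqP; rewrite -(@eqrXn2 _ 2)// ?mulr_ge0 ?ell2_norm_ge0 ?normc_ge0//.
rewrite exprMn; apply/eqP/EFin_inj.
by rewrite sqr_ell2_norm [RHS]EFinM sqr_ell2_norm; exact: (sqnormZ c x).
Qed.

Lemma ell2_normD x y : ell2_norm (x + y) <= ell2_norm x + ell2_norm y.
Proof.
have [x0|xn0] := eqVneq (ell2_norm x) 0.
  by rewrite (ell2_norm0_eq0 x0) add0r lerDr ell2_norm_ge0.
have [y0|yn0] := eqVneq (ell2_norm y) 0.
  by rewrite (ell2_norm0_eq0 y0) addr0 lerDl ell2_norm_ge0.
have xp : 0 < ell2_norm x by rewrite lt_neqAle eq_sym xn0 ell2_norm_ge0.
have yp : 0 < ell2_norm y by rewrite lt_neqAle eq_sym yn0 ell2_norm_ge0.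
rewrite -ler_sqr ?nnegrE ?addr_ge0 ?ell2_norm_ge0//.
rewrite -lee_fin sqr_ell2_norm (le_trans (sqnormD x y xp yp))//.
rewrite -!sqr_ell2_norm -!EFinM -EFinD lee_fin le_eqVlt; apply/orP; left.
by apply/eqP; field; rewrite xn0 yn0.
Qed.

Definition ell2_normC x : R[i] := (ell2_norm x)%:C.

Fact ell2_normCD x y : ell2_normC (x + y) <= ell2_normC x + ell2_normC y.
Proof. by rewrite /ell2_normC -rmorphD/= lecR ell2_normD. Qed.

Fact ell2_normCZ (c : R[i]) x : ell2_normC (c *: x) = `|c| * ell2_normC x.
Proof. by rewrite /ell2_normC ell2_normZ rmorphM. Qed.

Fact ell2_normC0_eq0 x : ell2_normC x = 0 -> x = 0.
Proof. by move=> [] /ell2_norm0_eq0. Qed.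

HB.instance Definition _ := Lmodule_isNormed.Build R[i] (ell2 R I)
  ell2_normCD ell2_normCZ ell2_normC0_eq0.

Lemma delta_summable (j : I) :
  (fun i => (i == j)%:R : R[i]) \in square_summable.
Proof.
rewrite inE /sqnorm (_ : esum _ _ = 1%E) ?ltry//.
rewrite -(@esum_set1 R I j (fun=> 1%E))// [RHS]esum_mkcond.
apply: eq_esum => i _; rewrite (_ : (i \in [set j]) = (i == j)); last by apply/idP/eqP => [/set_mem|->]; rewrite ?inE.
by case: eqP => _; rewrite ?Normc.normc1 ?Normc.normc0 ?expr1n ?expr0n.
Qed.

Definition delta (j : I) : ell2 R I := Ell2 (delta_summable j).

(* Sum of an absolutely summable family. The value on any other family is a
   junk one, but x i * (y i)^* is absolutely summable for x, y in ell2. *)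
Definition rsum (f : I -> R) : R :=
  fine (\esum_(i in [set: I]) (f^\+ i)%:E - \esum_(i in [set: I]) (f^\- i)%:E).

Definition csum (f : I -> R[i]) : R[i] :=
  rsum (fun i => complex.Re (f i)) +i* rsum (fun i => complex.Im (f i)).

Definition inner x y : R[i] := csum (fun i => x i * (y i)^*).

Lemma inner_sqr_norm x : inner x x = `|x| ^+ 2.
Proof.
have xxE : (fun i => x i * (x i)^*) = (fun i => (Normc.normc (x i) ^+ 2)%:C).
  by apply/funext => i; rewrite -sqr_normc rmorphXn.
have -> : `|x| ^+ 2 = (ell2_norm x ^+ 2)%:C by rewrite rmorphXn.
rewrite /inner xxE /csum; congr (_ +i* _); rewrite /rsum.
- rewrite [X in (_ - X)%E]esum1 => [|i _]; last first.
    by rewrite /funrneg/= max_r// oppr_le0 sqr_ge0.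
  rewrite sube0 -[RHS]/(fine (ell2_norm x ^+ 2)%:E) sqr_ell2_norm.
  by congr fine; apply: eq_esum => i _; rewrite /funrpos/= max_l// sqr_ge0.
- rewrite !esum1 ?sube0// => i _.
  + by rewrite /funrneg/= oppr0 maxxx.
  + by rewrite /funrpos/= maxxx.
Qed.

End Ell2Norm.

Section OperatorAlgebras.
Context {R : realType} {I : choiceType}.
Local Notation H := (ell2 R I).
Implicit Types (A B : H -> H) (S : set (H -> H)) (M : set H).

Definition bounded_op : set (H -> H) :=
  [set A | linear A /\ exists c : R[i], forall x, `|A x| <= c * `|x|].

Definition is_adjoint A B : Prop :=
  bounded_op B /\ forall x y, inner (A x) y = inner x (B y).

(* The coarsest topology making every A |-> <A x, y> continuous. It is put on
   all maps H -> H; the weak operator topology is its trace on bounded_op. *)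
Definition wot : Type := @initial_topology (H -> H) {ptws H * H -> R[i]^o}
  (fun A p => inner (A p.1) p.2).

Definition wot_closed S : Prop :=
  exists2 F : set wot, closed F & S = bounded_op `&` F.

Definition unital_op_algebra S : Prop :=
  [/\ S `<=` bounded_op, S idfun,
      forall (c : R[i]) A B, S A -> S B -> S (c *: A + B) &
      forall A B, S A -> S B -> S (A \o B)].

Definition wot_algebra (G : set (H -> H)) : set (H -> H) :=
  smallest [set S | unital_op_algebra S /\ wot_closed S] G.

Definition closed_subspace M : Prop :=
  [/\ M 0, forall (c : R[i]) x y, M x -> M y -> M (c *: x + y) & closed M].

Definition Lat S : set (set H) :=
  [set M | closed_subspace M /\ forall A, S A -> A @` M `<=` M].

Definition Alg (L : set (set H)) : set (H -> H) :=
  [set A | bounded_op A /\ forall M, L M -> A @` M `<=` M].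

Definition reflexive_algebra S : Prop := S = Alg (Lat S).

End OperatorAlgebras.

(* The word i_k ... i_1 is the list [:: i_k; ...; i_1], so that i w is i :: w
   and the empty word e is [::]. *)
Definition word (n : nat) := seq 'I_n.

Section WeightedShifts.
Context {R : realType} {n : nat}.
Local Notation Fock := (ell2 R (word n)).
Implicit Types (lam : 'I_n -> word n -> R) (T : 'I_n -> Fock -> Fock).

Definition weighted_shift lam T : Prop :=
  forall i, bounded_op (T i) /\
    forall w, T i (delta w) = (lam i w)%:C *: delta (i :: w).

Fixpoint weight lam (u w : word n) : R :=
  if w is i :: w' then weight lam u w' * lam i (w' ++ u) else 1.

Definition adjoint_eigenvalues T : set 'rV[R[i]^o]_n :=
  [set l | exists2 x : Fock, x != 0 &
    forall i, exists2 B, is_adjoint (T i) B & B x = l 0 i *: x].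

End WeightedShifts.

(* Main.v *)
(* An operator A in Alg Lat is recovered from its Fourier coefficients
   a_u = (A xi_e)(u) / W(e,u) once one knows that A xi_w = R_w A xi_e / W(e,w)
   for all words w, where R_w xi_v = W(e,vw) / W(e,v) xi_{vw} formally commutes
   with the T_i. To see this, fix w <> e and a small mu > 0. If u does not end
   in w, then y_u = sum_k mu^k / W(e,uw^k) xi_{uw^k} is an eigenvector of R_w^*
   for mu; it is square summable because it is dominated by an eigenvector of
   the adjoint algebra all of whose eigenvalues are nonzero. The orthogonal
   complement of these y_u is invariant under the T_i, hence under A, and
   contains W(e,w) xi_w - mu xi_e. Comparing the powers of mu in the resulting
   identities gives the intertwining relation. Finally the Fejer means of the
   Fourier series of A are averages of compressions of A, thus uniformly
   bounded, and converge to A in the weak operator topology. *)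

Require Import Defs.
From mathcomp Require Import all_boot all_order all_algebra.
From mathcomp Require Import all_classical all_reals all_analysis.
From mathcomp Require Import complex.
From mathcomp Require Import ring lra zify.
Import Order.TTheory GRing.Theory Num.Theory.
Import numFieldNormedType.Exports.
Local Open Scope classical_set_scope.
Local Open Scope complex_scope.
Local Open Scope ring_scope.

Set Implicit Arguments.
Unset Strict Implicit.
Unset Printing Implicit Defensive.

Lemma conj_realC (R : realType) (a : R) : (a%:C : R[i])^* = a%:C.
Proof. exact: conjc_real. Qed.

Lemma realC_neq0 (R : realType) (a : R) : 0 < a -> (a%:C : R[i]) != 0.
Proof. by move=> a0; rewrite gt_eqF// -[0]/(0%:C) ltcR. Qed.

Lemma gt0_realC (R : rcfType) (c : R[i]) : 0 < c ->
  exists2 k : R, 0 < k & c = k%:C.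
Proof.
move=> c0; have cE := RRe_real (gtr0_real c0).
by exists (complex.Re c); rewrite ?cE// -ltcR cE.
Qed.

(** * Sums of absolutely summable real and complex families *)

Section Sums.
Context {R : realType} {I : choiceType}.
Implicit Types (f g a b : I -> R) (F G : I -> R[i]).

Definition rsummable f := summable [set: I] (EFin \o f).

Lemma rsummable_le f g : (forall i, `|f i| <= g i) -> rsummable g -> rsummable f.
Proof.
move=> fg; apply: le_lt_trans; apply: le_esum => i _ /=.
by rewrite lee_fin (le_trans (fg i))// ler_norm.
Qed.

Lemma rsummableD f g : rsummable f -> rsummable g -> rsummable (f \+ g).
Proof. by move=> sf sg; have := summableD sf sg. Qed.

Lemma rsummableZ (c : R) f : rsummable f -> rsummable (fun i => c * f i).
Proof.
rewrite /rsummable /summable => sf.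
under eq_esum do rewrite /= normrM.
by rewrite esumZl// lte_mul_pinfty ?lee_fin//; apply: esum_ge0.
Qed.

Lemma esum_fin_num a : (forall i, 0 <= a i) -> rsummable a ->
  \esum_(i in [set: I]) (a i)%:E \is a fin_num.
Proof.
move=> a0; rewrite /rsummable summableE => sa; congr (_ \is a _): sa.
by apply: eq_esum => i _ /=; rewrite ger0_norm.
Qed.

(** The value does not depend on how [f] is written as a difference of nonnegative summable
    families. Additivity needs this, since the positive part of a sum is not the sum of the positive
    parts. *)
Lemma rsum_split f a b : (forall i, 0 <= a i) -> (forall i, 0 <= b i) ->
  rsummable a -> rsummable b -> (forall i, f i = a i - b i) ->
  rsum f = fine (\esum_(i in [set: I]) (a i)%:E)
         - fine (\esum_(i in [set: I]) (b i)%:E).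
Proof.
move=> a0 b0 sa sb fE.
rewrite -fineB ?esum_fin_num// -esumB//=; last 2 first.
- by move=> i _; rewrite lee_fin.
- by move=> i _; rewrite lee_fin.
rewrite /rsum; congr (fine (_ - _)%E); apply: eq_esum => i _.
- by rewrite funeposE /funrpos/= fE EFin_max.
- by rewrite funenegE /funrneg/= fE EFin_max.
Qed.

Lemma rsummable_pos f : rsummable f -> rsummable f^\+.
Proof.
rewrite /rsummable /summable; apply: le_lt_trans; apply: le_esum => i _ /=.
by rewrite lee_fin ger0_norm// /funrpos ge_max ler_norm normr_ge0.
Qed.

Lemma rsummable_neg f : rsummable f -> rsummable f^\-.
Proof.
rewrite /rsummable /summable; apply: le_lt_trans; apply: le_esum => i _ /=.
by rewrite lee_fin ger0_norm// /funrneg ge_max normr_ge0 -normrN ler_norm.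
Qed.

Lemma rsum_posneg f : rsummable f ->
  rsum f = fine (\esum_(i in [set: I]) (f^\+ i)%:E)
         - fine (\esum_(i in [set: I]) (f^\- i)%:E).
Proof.
move=> sf; apply: rsum_split => // [||i].
- exact: rsummable_pos.
- exact: rsummable_neg.
- by rewrite -[in LHS](funrposBneg f).
Qed.

Lemma fine_esumD a b : (forall i, 0 <= a i) -> (forall i, 0 <= b i) ->
  rsummable a -> rsummable b ->
  fine (\esum_(i in [set: I]) (a i + b i)%:E) =
  fine (\esum_(i in [set: I]) (a i)%:E) + fine (\esum_(i in [set: I]) (b i)%:E).
Proof.
move=> a0 b0 sa sb.
rewrite -fineD ?esum_fin_num// -esumD// => i _; by rewrite lee_fin.
Qed.

Lemma fine_esumZ (c : R) a : 0 <= c -> (forall i, 0 <= a i) -> rsummable a ->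
  fine (\esum_(i in [set: I]) (c * a i)%:E) =
  c * fine (\esum_(i in [set: I]) (a i)%:E).
Proof.
by move=> c0 a0 sa; rewrite esumZl// fineM// esum_fin_num.
Qed.

Lemma rsumD f g : rsummable f -> rsummable g -> rsum (f \+ g) = rsum f + rsum g.
Proof.
move=> sf sg; have [pf nf] := (rsummable_pos sf, rsummable_neg sf).
have [pg ng] := (rsummable_pos sg, rsummable_neg sg).
rewrite (@rsum_split _ (f^\+ \+ g^\+) (f^\- \+ g^\-)) => [|i|i|||i]; last first.
- by rewrite /= -[in LHS](funrposBneg f) -[in LHS](funrposBneg g) !fctE; ring.
- exact: rsummableD.
- exact: rsummableD.
- by rewrite addr_ge0.
- by rewrite addr_ge0.
rewrite (rsum_posneg sf) (rsum_posneg sg).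
rewrite (fine_esumD (funrpos_ge0 f) (funrpos_ge0 g) pf pg).
by rewrite (fine_esumD (funrneg_ge0 f) (funrneg_ge0 g) nf ng); ring.
Qed.

Lemma rsumZ (c : R) f : rsummable f -> rsum (fun i => c * f i) = c * rsum f.
Proof.
move=> sf; have [pf nf] := (rsummable_pos sf, rsummable_neg sf).
rewrite (rsum_posneg sf); have [c0|c0] := leP 0 c.
- rewrite (@rsum_split _ (fun i => c * f^\+ i) (fun i => c * f^\- i)) => [|i|i|||i].
  + rewrite (fine_esumZ c0 (funrpos_ge0 f) pf).
    by rewrite (fine_esumZ c0 (funrneg_ge0 f) nf) mulrBr.
  + exact: mulr_ge0.
  + exact: mulr_ge0.
  + exact: rsummableZ.
  + exact: rsummableZ.
  + by rewrite -mulrBr -[in LHS](funrposBneg f).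
- have c0' : 0 <= - c by rewrite oppr_ge0 ltW.
  rewrite (@rsum_split _ (fun i => - c * f^\- i) (fun i => - c * f^\+ i)) => [|i|i|||i].
  + rewrite (fine_esumZ c0' (funrpos_ge0 f) pf).
    by rewrite (fine_esumZ c0' (funrneg_ge0 f) nf); ring.
  + exact: mulr_ge0.
  + exact: mulr_ge0.
  + exact: rsummableZ.
  + exact: rsummableZ.
  + by rewrite -[in LHS](funrposBneg f) !fctE; ring.
Qed.

Lemma rsum_single (j : I) f : (forall i, i != j -> f i = 0) -> rsum f = f j.
Proof.
move=> fj.
have single g : (forall i, 0 <= g i) -> (forall i, i != j -> g i = 0) ->
    \esum_(i in [set: I]) (g i)%:E = (g j)%:E.
  move=> g0 gj; rewrite -(@esum_set1 R I j (fun i => (g i)%:E)) ?lee_fin//.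
  rewrite [RHS]esum_mkcond; apply: eq_esum => i _.
  by case: ifPn => //; rewrite notin_setE => /eqP/gj ->.
rewrite /rsum !single//= => [|i ij|i ij].
- by rewrite -[RHS](congr1 (@^~ j) (funrposBneg f)).
- by rewrite /funrneg fj// oppr0 maxxx.
- by rewrite /funrpos fj// maxxx.
Qed.

Definition csummable F :=
  rsummable (fun i => complex.Re (F i)) /\ rsummable (fun i => complex.Im (F i)).

Lemma csumD F G : csummable F -> csummable G -> csum (F \+ G) = csum F + csum G.
Proof.
move=> [Fr Fi] [Gr Gi]; rewrite /csum.
rewrite (_ : (fun i => _) =
  (fun i => complex.Re (F i)) \+ (fun i => complex.Re (G i))); last first.
  by apply/funext => i /=; case: (F i) (G i) => ? ? [].
rewrite rsumD//.
rewrite (_ : (fun i => complex.Im ((F \+ G) i)) =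
  (fun i => complex.Im (F i)) \+ (fun i => complex.Im (G i))); last first.
  by apply/funext => i /=; case: (F i) (G i) => ? ? [].
by rewrite rsumD.
Qed.

Lemma csumZ (c : R[i]) F : csummable F -> csum (fun i => c * F i) = c * csum F.
Proof.
case: c => a b [Fr Fi]; rewrite /csum.
rewrite (_ : (fun i => _) =
  (fun i => a * complex.Re (F i)) \+ (fun i => - b * complex.Im (F i))); last first.
  by apply/funext => i /=; case: (F i) => ? ? /=; rewrite mulNr.
rewrite rsumD ?rsumZ//; [|exact: rsummableZ..].
rewrite (_ : (fun i => complex.Im (a +i* b * F i)) =
  (fun i => a * complex.Im (F i)) \+ (fun i => b * complex.Re (F i))); last first.
  by apply/funext => i /=; case: (F i) => ? ? /=; ring.
rewrite rsumD ?rsumZ//; [|exact: rsummableZ..].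
by simpc; congr (_ +i* _); ring.
Qed.

Lemma csum_conj F : csummable F -> csum (fun i => (F i)^*) = (csum F)^*.
Proof.
move=> [Fr Fi]; rewrite /csum.
rewrite (_ : (fun i => _) = fun i => complex.Re (F i)); last first.
  by apply/funext => i; case: (F i).
rewrite (_ : (fun i => complex.Im _) = (fun i => -1 * complex.Im (F i))); last first.
  by apply/funext => i; case: (F i) => ? ? /=; rewrite mulN1r.
by rewrite rsumZ// mulN1r.
Qed.

Lemma csum_single (j : I) F : (forall i, i != j -> F i = 0) -> csum F = F j.
Proof.
by move=> Fj; rewrite /csum !(@rsum_single j) => [|i /Fj ->//|i /Fj ->//]; case: (F j).
Qed.

End Sums.

(** * Sesquilinearity of the inner product *)

Section InnerProduct.
Context {R : realType} {I : choiceType}.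
Local Notation H := (ell2 R I).
Implicit Types x y z : H.

Lemma summable_sqnorm x : rsummable (fun i => Normc.normc (x i) ^+ 2).
Proof.
case: x => x /=; rewrite inE /rsummable /summable /= /sqnorm => xs.
by under eq_esum do rewrite ger0_norm ?sqr_ge0//.
Qed.

Lemma norm_Re_Im_le (z : R[i]) :
  `|complex.Re z| <= Normc.normc z /\ `|complex.Im z| <= Normc.normc z.
Proof.
case: z => a b /=; rewrite -!sqrtr_sqr; split; rewrite ler_wsqrtr//.
  by rewrite lerDl sqr_ge0.
by rewrite lerDr sqr_ge0.
Qed.

Lemma normc_conj (z : R[i]) : Normc.normc z^* = Normc.normc z.
Proof. by case: z => a b /=; rewrite sqrrN. Qed.

(** Each product is dominated by the sum of the squared moduli, so [csum] takes no junk value in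
    [inner]; all the algebraic rules below rest on this. *)
Lemma inner_csummable x y : csummable (fun i => x i * (y i)^*).
Proof.
have dom : rsummable ((fun i => Normc.normc (x i) ^+ 2) \+
                      (fun i => Normc.normc (y i) ^+ 2)).
  by apply: rsummableD; exact: summable_sqnorm.
have le i :
    Normc.normc (x i * (y i)^*) <= Normc.normc (x i) ^+ 2 + Normc.normc (y i) ^+ 2.
  rewrite Normc.normcM normc_conj.
  have := normc_ge0 (x i); have := normc_ge0 (y i).
  by move: (Normc.normc _) (Normc.normc _) => a b; nra.
by split; apply: rsummable_le dom => i; apply: le_trans (le i);
  case: (norm_Re_Im_le (x i * (y i)^*)).
Qed.

Lemma innerDl x y z : inner (x + y) z = inner x z + inner y z.
Proof.
rewrite /inner -csumD; [|exact: inner_csummable..].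
by congr csum; apply/funext => i; rewrite /= mulrDl.
Qed.

Lemma innerZl (c : R[i]) x z : inner (c *: x) z = c * inner x z.
Proof.
rewrite /inner -csumZ; last exact: inner_csummable.
by congr csum; apply/funext => i; rewrite mulrA.
Qed.

Lemma inner_conj x y : (inner x y)^* = inner y x.
Proof.
rewrite /inner -csum_conj; last exact: inner_csummable.
by congr csum; apply/funext => i; rewrite rmorphM/= conjCK mulrC.
Qed.

Lemma innerDr x y z : inner x (y + z) = inner x y + inner x z.
Proof. by rewrite -inner_conj innerDl rmorphD/= !inner_conj. Qed.

Lemma innerZr (c : R[i]) x z : inner x (c *: z) = c^* * inner x z.
Proof. by rewrite -inner_conj innerZl rmorphM/= inner_conj. Qed.

Lemma inner_deltar x i : inner x (delta i) = x i.
Proof.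
rewrite /inner (@csum_single _ _ i) => [|j ji]; first by rewrite /= eqxx conjC1 mulr1.
by rewrite /= (negbTE ji) conjC0 mulr0.
Qed.

Lemma inner_deltal x i : inner (delta i) x = (x i)^*.
Proof. by rewrite -inner_conj inner_deltar. Qed.

End InnerProduct.

Lemma ler_sum_codom (R : numDomainType) (I : eqType) (J : finType) (e : J -> I)
    (s : seq I) (f : I -> R) : injective e -> uniq s -> {subset s <= codom e} ->
  (forall i, 0 <= f i) -> \sum_(i <- s) f i <= \sum_j f (e j).
Proof.
move=> e_inj s_uniq se f0.
have -> : \sum_j f (e j) = \sum_(i <- codom e) f i by rewrite big_map big_enum.
rewrite [leRHS](bigID (mem s))/= -[X in _ <= X + _]big_filter.
rewrite (perm_big [seq i <- codom e | i \in s]) ?lerDl ?sumr_ge0//.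
apply: uniq_perm => //; first by rewrite filter_uniq// map_inj_uniq// enum_uniq.
by move=> i; rewrite mem_filter; case: (boolP (i \in s)) => // /se ->.
Qed.

Lemma ell2_scaleE (R : realType) (I : choiceType) (c : R[i]) (x : ell2 R I) i :
  (c *: x) i = c * x i.
Proof. by []. Qed.

Lemma deltaE (R : realType) (I : choiceType) (i j : I) :
  delta j i = (i == j)%:R :> R[i].
Proof. by []. Qed.

Lemma linearZ_bounded (R : realType) (I : choiceType) (A : ell2 R I -> ell2 R I)
  (c : R[i]) x : bounded_op A -> A (c *: x) = c *: A x.
Proof.
move=> [lA _]; have A0 : A 0 = 0.
  by have := lA (-1) 0 0; rewrite scaler0 addr0 scaleN1r addNr.
by rewrite -[c *: x]addr0 lA A0 addr0.
Qed.

(** * Cauchy-Schwarz, domination and finite truncations *)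

Section InnerProductTheory.
Context {R : realType} {I : choiceType}.
Local Notation H := (ell2 R I).
Implicit Types x y z : H.

Lemma inner0l x : inner 0 x = 0 :> R[i].
Proof. by rewrite -(scale0r (0 : H)) innerZl mul0r. Qed.

Lemma inner0r x : inner x 0 = 0 :> R[i].
Proof. by rewrite -inner_conj inner0l conjC0. Qed.

Lemma innerNl x y : inner (- x) y = - inner x y.
Proof. by rewrite -scaleN1r innerZl mulN1r. Qed.

Lemma innerNr x y : inner x (- y) = - inner x y.
Proof. by rewrite -inner_conj innerNl rmorphN/= inner_conj. Qed.

Lemma innerBl x y z : inner (x - y) z = inner x z - inner y z.
Proof. by rewrite innerDl innerNl. Qed.

Lemma innerBr x y z : inner x (y - z) = inner x y - inner x z.
Proof. by rewrite innerDr innerNr. Qed.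

Lemma inner_suml (J : Type) (s : seq J) (P : pred J) (F : J -> H) y :
  inner (\sum_(j <- s | P j) F j) y = \sum_(j <- s | P j) inner (F j) y.
Proof. by rewrite (big_morph (inner^~ y) (fun a b => innerDl a b y) (inner0l y)). Qed.

Lemma inner_sumr (J : Type) (s : seq J) (P : pred J) (F : J -> H) y :
  inner y (\sum_(j <- s | P j) F j) = \sum_(j <- s | P j) inner y (F j).
Proof. by rewrite (big_morph (inner y) (innerDr y) (inner0r y)). Qed.

Lemma Cauchy_Schwarz x y : `|inner x y| <= `|x| * `|y|.
Proof.
have [->|y0] := eqVneq y 0; first by rewrite inner0r !normr0 mulr0.
rewrite -ler_sqr ?nnegrE ?mulr_ge0// exprMn.
set N := `|y| ^+ 2; set s := inner x y.
have N0 : 0 < N by rewrite exprn_gt0// normr_gt0.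
have NJ : N^* = N by rewrite conj_Creal// gtr0_real.
(* [(s / N) *: y] is the projection of [x] on the line of [y]; the inequality is the expansion of
   the squared residual. *)
have : 0 <= `|x - (s / N) *: y| ^+ 2 by rewrite exprn_ge0.
rewrite -inner_sqr_norm innerBl !innerBr innerZl !innerZr innerZl.
rewrite -(inner_conj x y) -/s !inner_sqr_norm -/N rmorphM/= fmorphV/= NJ normCK.
have -> : `|x| ^+ 2 - s^* / N * s - (s / N * s^* - s^* / N * (s / N * N))
   = `|x| ^+ 2 - s * s^* / N by field; rewrite gt_eqF.
by rewrite subr_ge0 ler_pdivrMr.
Qed.

Lemma inner_continuousl y : continuous (fun x : H => inner x y : R[i]^o).
Proof.
move=> x; have FF : Filter (nbhs x) := nbhs_filter x.
apply/cvgrPdist_lt => e e0; near=> z.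
rewrite -innerBl; apply: le_lt_trans (Cauchy_Schwarz _ _) _.
(* The 1 keeps the divisor positive when [y] is zero. *)
have y1 : 0 < `|y| + 1 by rewrite ltr_wpDl.
apply: (@le_lt_trans _ _ (`|x - z| * (`|y| + 1))); first by rewrite ler_wpM2l// lerDl.
rewrite -ltr_pdivlMr//; near: z.
by apply/(@nbhs_normP R[i] H); exists (e / (`|y| + 1)); rewrite //= divr_gt0.
Unshelve. all: by end_near. Qed.

(** The norm bound is stated for every vector with coordinates [f], because [f] becomes a vector
    only through the first half. *)
Lemma ell2_dominated (K : R) (f : I -> R[i]) x : 0 <= K ->
  (forall i, Normc.normc (f i) <= K * Normc.normc (x i)) ->
  f \in square_summable /\
  forall y, (forall i, y i = f i) -> `|y| <= K%:C * `|x|.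
Proof.
move=> K0 fx.
have le : (sqnorm f <= (K ^+ 2)%:E * sqnorm x)%E.
  rewrite /sqnorm -esumZl ?sqr_ge0// => [|i]; last exact: sqr_ge0.
  apply: le_esum => i _; rewrite lee_fin -exprMn ler_sqr ?nnegrE ?mulr_ge0 ?normc_ge0//.
split.
  rewrite inE (le_lt_trans le)// lte_mul_pinfty ?lee_fin ?sqr_ge0//.
  by rewrite -ge0_fin_numE ?sqnorm_ge0 ?sqnorm_fin.
move=> y yf.
rewrite -[X in X <= _]/((ell2_norm y)%:C) -[X in _ * X]/((ell2_norm x)%:C).
rewrite -rmorphM/= lecR -ler_sqr ?nnegrE ?mulr_ge0 ?ell2_norm_ge0//.
rewrite -lee_fin exprMn (EFinM (K ^+ 2)) !sqr_ell2_norm.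
by rewrite (_ : ell2_val y = f)//; apply/funext.
Qed.

Section FiniteCombinations.
Context (J : finType) (e : J -> I) (e_inj : injective e).
Implicit Types a b : J -> R[i].

(** Finitely supported vectors. For injective [e], [comb (x \o e)] is the orthogonal projection of
    [x] on the span of the [delta (e j)]. *)
Definition comb a : H := \sum_j a j *: delta (e j).

Lemma inner_comb_delta a j : inner (comb a) (delta (e j)) = a j.
Proof.
rewrite /comb inner_suml (bigD1 j)//= innerZl inner_deltar /= eqxx mulr1.
rewrite big1 ?addr0// => k kj.
by rewrite innerZl inner_deltar /= (inj_eq e_inj) eq_sym (negbTE kj) mulr0.
Qed.

Lemma inner_comb x a : inner x (comb a) = \sum_j (a j)^* * x (e j).
Proof.
by rewrite inner_sumr; apply: eq_bigr => j _; rewrite innerZr inner_deltar.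
Qed.

Lemma sqr_norm_comb a : `|comb a| ^+ 2 = \sum_j `|a j| ^+ 2.
Proof.
rewrite -inner_sqr_norm inner_comb; apply: eq_bigr => j _.
by rewrite -inner_deltar inner_comb_delta normCK mulrC.
Qed.

(** This is Pythagoras for that projection; Bessel's inequality and the approximation lemma both
    read off from it. *)
Lemma sqr_dist_comb x :
  `|x - comb (x \o e)| ^+ 2 = `|x| ^+ 2 - \sum_j `|x (e j)| ^+ 2.
Proof.
rewrite -inner_sqr_norm innerBl !innerBr inner_sqr_norm.
rewrite -[inner (comb _) x]inner_conj [inner (comb _) (comb _)]inner_sqr_norm.
rewrite sqr_norm_comb.
rewrite inner_comb rmorph_sum/=.
have -> : \sum_j ((x (e j))^* * x (e j))^* = \sum_j `|x (e j)| ^+ 2.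
  by apply: eq_bigr => j _; rewrite rmorphM/= conjCK normCK.
by rewrite (eq_bigr (fun j => `|x (e j)| ^+ 2)) => [|j _]; [ring|rewrite normCK mulrC].
Qed.

Lemma Bessel x : \sum_j `|x (e j)| ^+ 2 <= `|x| ^+ 2.
Proof. by rewrite -subr_ge0 -sqr_dist_comb exprn_ge0. Qed.

End FiniteCombinations.

(** The squared norm is a supremum of finite partial sums, and enlarging the index set only improves
    the truncation. Allowing every [J] that covers [X] lets two vectors share one truncation. *)
Lemma finite_approx x (eps : R) : 0 < eps ->
  exists X : seq I, forall (J : finType) (e : J -> I), injective e ->
    {subset X <= codom e} -> `|x - comb e (x \o e)| < eps%:C.
Proof.
move=> eps0.
have [] := @ub_ereal_sup_adherent _ _ (eps ^+ 2) _ (sqnorm_fin x).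
  by rewrite exprn_gt0.
move=> _ [X [finX _] <-] lt_X.
exists (finmap.enum_fset (fset_set X)) => J e e_inj Xe.
rewrite -ltr_sqr ?nnegrE ?normr_ge0 ?ler0c ?(ltW eps0)//.
rewrite sqr_dist_comb// -[`|x|]/((ell2_norm x)%:C) -!rmorphXn/=.
have -> : \sum_j `|x (e j)| ^+ 2 = (\sum_j Normc.normc (x (e j)) ^+ 2)%:C.
  by rewrite rmorph_sum; apply: eq_bigr => j _; rewrite rmorphXn.
rewrite -rmorphB/= ltcR ltrBlDr -ltrBlDl.
rewrite -lte_fin EFinB; rewrite -[ereal_sup _]/(sqnorm x) -sqr_ell2_norm in lt_X.
apply: lt_le_trans lt_X _.
rewrite fsbig_finite//= sumEFin lee_fin.
exact: (ler_sum_codom e_inj (finmap.fset_uniq _) Xe (fun i => sqr_ge0 _)).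
Qed.

End InnerProductTheory.

(** * Bounded operators, the weak operator topology and Alg Lat *)

Section Operators.
Context {R : realType} {I : choiceType}.
Local Notation H := (ell2 R I).
Implicit Types (A B : H -> H) (S : set (H -> H)) (x y : H) (Y : set H).

Lemma bounded_opP A : bounded_op A -> exists2 c : R[i], 0 <= c &
  forall x, `|A x| <= c * `|x|.
Proof.
move=> [_ [c cA]]; exists `|c| => // x.
(* [c] may fail to be a nonnegative real, but its product with the norm of [x] is one, hence equals
   its own modulus. *)
have : 0 <= c * `|x| by rewrite (le_trans _ (cA x)).
by move=> /ger0_norm cx; rewrite (le_trans (cA x))// -cx normrM normr_id.
Qed.

Lemma bounded_op_id : bounded_op (idfun : H -> H).
Proof. by split => //; exists 1 => x; rewrite mul1r. Qed.

Lemma bounded_op_lin (c : R[i]) A B :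
  bounded_op A -> bounded_op B -> bounded_op (c *: A + B).
Proof.
move=> bA bB; have [[lA _] [lB _]] := (bA, bB).
have [a a0 aA] := bounded_opP bA; have [b b0 bB'] := bounded_opP bB.
split.
  move=> k x y; rewrite !fctE lA lB !scalerDr !scalerA (mulrC c k).
  by rewrite addrACA.
exists (`|c| * a + b) => x; rewrite !fctE.
rewrite (le_trans (ler_normD _ _))// mulrDl lerD// normrZ -mulrA.
by rewrite ler_wpM2l.
Qed.

Lemma bounded_op_comp A B : bounded_op A -> bounded_op B -> bounded_op (A \o B).
Proof.
move=> bA bB; have [[lA _] [lB _]] := (bA, bB).
have [a a0 aA] := bounded_opP bA; have [b b0 bB'] := bounded_opP bB.
split; first by move=> k x y /=; rewrite lB lA.
by exists (a * b) => x /=; rewrite (le_trans (aA _))// -mulrA ler_wpM2l.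
Qed.

Lemma bounded_op_algebra : unital_op_algebra (@bounded_op R I).
Proof.
split=> //; [exact: bounded_op_id|exact: bounded_op_lin|exact: bounded_op_comp].
Qed.

Lemma continuous_wot x y : continuous (fun A : wot => inner (A x) y : R[i]^o).
Proof.
move=> A; have FF : Filter (nbhs A) := nbhs_filter A.
pose f (B : H -> H) (p : H * H) : R[i]^o := inner (B p.1) p.2.
have : (f @ (nbhs (A : wot))) --> (f A : {ptws H * H -> R[i]^o}).
  exact: (@initial_continuous (H -> H) {ptws H * H -> R[i]^o} f A).
by move=> /pointwise_cvgP => /(_ (x, y)).
Qed.

(** Convergence of all coefficients [inner (A_ k x) y] is convergence in the initial topology [wot],
    and closed sets keep limits. *)
Lemma wot_closed_lim S (A_ : nat -> H -> H) A : wot_closed S -> bounded_op A ->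
  (forall k, S (A_ k)) ->
  (forall x y, (fun k => inner (A_ k x) y : R[i]^o) @ \oo --> (inner (A x) y : R[i]^o)) ->
  S A.
Proof.
move=> [F clF ->] bA SA_ lim; split => //.
suff AF : ((fun k => A_ k : wot) @ \oo --> (A : wot)).
  by apply: (closed_cvg _ clF _ _ AF); apply: nearW => k; case: (SA_ k).
move=> P; rewrite nbhsE => -[Q [[V oV <-] VA] QP].
pose f (B : H -> H) (p : H * H) : R[i]^o := inner (B p.1) p.2.
have : (fun k => f (A_ k)) @ \oo --> (f A : {ptws H * H -> R[i]^o}).
  by apply/pointwise_cvgP => -[x y]; exact: lim.
move=> /(_ V) h.
have : \forall k \near \oo, V (f (A_ k)) by apply: h; exact: open_nbhs_nbhs.
by apply: filterS => k /QP.
Qed.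

Definition perp Y : set H := [set x | forall y, Y y -> inner x y = 0].

Lemma closed_subspace_perp Y : closed_subspace (perp Y).
Proof.
split=> [y _|c x z Yx Yz y Yy|]; first exact: inner0l.
  by rewrite innerDl innerZl Yx// Yz// mulr0 addr0.
have -> : perp Y = \bigcap_(y in Y) ((fun x => inner x y : R[i]^o) @^-1` [set 0]).
  by [].
apply: closed_bigI => y _; apply: preimage_closed.
  by move=> x _; exact: inner_continuousl.
exact: (accessible_closed_set1 (hausdorff_accessible (@norm_hausdorff R[i] R[i]^o))).
Qed.

Lemma wot_algebra_le G S : G `<=` S -> unital_op_algebra S -> wot_closed S ->
  wot_algebra G `<=` S.
Proof. by move=> GS aS cS A; apply; split. Qed.

(** Invariance is built into [Lat]; boundedness holds because [bounded_op] is itself a unital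
    WOT-closed algebra. *)
Lemma sub_Alg_Lat G : G `<=` @bounded_op R I ->
  wot_algebra G `<=` Alg (Lat (wot_algebra G)).
Proof.
move=> Gb A GA; split=> [|M [_]]; last exact.
apply: (wot_algebra_le Gb) GA; first exact: bounded_op_algebra.
by exists setT; [exact: closedT|rewrite setIT].
Qed.

(* The operators leaving a fixed orthogonal complement invariant form a
   WOT-closed algebra, so invariance need only be tested on generators. *)
Lemma Alg_Lat_perp G Y A : G `<=` @bounded_op R I ->
  (forall B, G B -> B @` perp Y `<=` perp Y) ->
  Alg (Lat (wot_algebra G)) A -> forall x, perp Y x -> perp Y (A x).
Proof.
move=> Gb GY [_ LA] x Yx; apply: (LA (perp Y)); last by exists x.
split; first exact: closed_subspace_perp.
pose S := [set B | bounded_op B /\ B @` perp Y `<=` perp Y].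
suff : wot_algebra G `<=` S by move=> GS B /GS[].
apply: wot_algebra_le => [B GB||]; first by split; [exact: Gb|exact: GY].
  split=> [B []//||c B C [bB YB] [bC YC]|B C [bB YB] [bC YC]].
  - by split; [exact: bounded_op_id|move=> _ [z Yz <-]].
  - split; first exact: bounded_op_lin.
    move=> _ [z Yz <-]; have [_ h _] := closed_subspace_perp Y.
    by apply: h; [apply: YB|apply: YC]; exists z.
  - split; first exact: bounded_op_comp.
    by move=> _ [z Yz <-]; apply: YB; exists (C z) => //; apply: YC; exists z.
(* Invariance of [perp Y] is the vanishing of the coefficients at all pairs from [perp Y] and [Y],
   each a WOT-closed condition. *)
exists (\bigcap_(p in [set p | perp Y p.1 /\ Y p.2])
    ((fun B : wot => inner (B p.1) p.2 : R[i]^o) @^-1` [set 0])).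
  apply: closed_bigI => p _; apply: preimage_closed.
    by move=> B _; exact: continuous_wot.
  exact: (accessible_closed_set1 (hausdorff_accessible (@norm_hausdorff R[i] R[i]^o))).
apply/seteqP; split=> B [bB h]; split=> //.
  by move=> [z y] [/= Yz Yy]; apply: h => //; exists z.
by move=> _ [z Yz <-] y Yy; exact: (h (z, y)).
Qed.

End Operators.

(** * Eigenvectors of the adjoints of a weighted shift *)

Section Shift.
Context {R : realType} {n : nat} (lam : 'I_n -> word n -> R).
Context (lam_gt0 : forall i w, 0 < lam i w).
Context (T : 'I_n -> ell2 R (word n) -> ell2 R (word n)).
Context (T_shift : weighted_shift lam T).
Local Notation H := (ell2 R (word n)).
Local Notation W := (weight lam [::]).
Implicit Types (u v w : word n) (x y : H).

Lemma weight_cons i v : W (i :: v) = W v * lam i v.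
Proof. by rewrite /= cats0. Qed.

Lemma weight_gt0 v : 0 < W v.
Proof. by elim: v => // i v IH; rewrite weight_cons mulr_gt0. Qed.

Lemma adjoint_coord i B y v : is_adjoint (T i) B ->
  B y v = (lam i v)%:C * y (i :: v).
Proof.
move=> [_ adjB]; rewrite -inner_deltar -inner_conj -adjB (T_shift i).2.
by rewrite innerZl inner_deltal rmorphM/= conjCK conj_realC.
Qed.

Context (l : 'rV[R[i]^o]_n) (nu : H) (B : 'I_n -> H -> H).
Context (l_neq0 : forall i, l 0 i != 0).
Context (nu_neq0 : nu != 0).
Context (T_adj : forall i, is_adjoint (T i) (B i)).
Context (nu_eig : forall i, B i nu = l 0 i *: nu).

(** The modulus of the monomial with exponent word [v] at the eigenvalue [l]; a real number
    suffices, as only sizes of coordinates are compared. *)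
Definition monomial v : R := \prod_(i <- v) Normc.normc (l 0 i).

Lemma normc_gt0 (z : R[i]) : z != 0 -> 0 < Normc.normc z.
Proof.
move=> z0; rewrite lt_neqAle normc_ge0 andbT eq_sym.
by apply: contra z0 => /eqP/Normc.eq0_normc ->.
Qed.

Lemma monomial_gt0 v : 0 < monomial v.
Proof. by apply: prodr_gt0 => i _; exact/normc_gt0/l_neq0. Qed.

(** At coordinate [v] the eigenvalue equation is a recursion from [nu v] to [nu (i :: v)], so every
    modulus is determined by the one at the empty word. *)
Lemma eigenvector_coord v :
  Normc.normc (nu v) = monomial v / W v * Normc.normc (nu [::]).
Proof.
elim: v => [|i v IH]; first by rewrite /monomial big_nil invr1 !mul1r.
have /(congr1 (@Normc.normc R)) : B i nu v = l 0 i * nu v by rewrite nu_eig.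
rewrite (adjoint_coord _ _ (T_adj i)) !Normc.normcM IH weight_cons.
rewrite /monomial big_cons /= expr0n addr0 sqrtr_sqr ger0_norm ?ltW// => e.
apply: (mulfI (lt0r_neq0 (lam_gt0 i v))); rewrite e.
by field; rewrite !gt_eqF ?weight_gt0.
Qed.

Lemma eigenvector_nil_gt0 : 0 < Normc.normc (nu [::]).
Proof.
rewrite lt_neqAle normc_ge0 andbT eq_sym; apply: contra nu_neq0 => /eqP e0.
apply/eqP/val_inj/funext => v; apply: Normc.eq0_normc.
by rewrite eigenvector_coord e0 mulr0.
Qed.

(** * The vectors y_u attached to a nonempty word w *)

Section PowerVectors.
Context (w : word n).
Context (w_gt0 : (0 < size w)%N).

Definition wpow k : word n := iter k (cat w) [::].

Lemma wpowS k : wpow k.+1 = w ++ wpow k. Proof. by []. Qed.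

Lemma size_wpow k : size (wpow k) = (k * size w)%N.
Proof. by elim: k => // k IH; rewrite wpowS size_cat IH mulSn. Qed.

(** Coordinate [v] of y_u. As [w] is nonempty, [k] is the only power for which [u ++ wpow k] can
    have the length of [v], so a single test decides. If [v] is shorter than [u], truncated
    subtraction gives [k] = 0 and the test fails. *)
Definition power_coef u (mu : R) v : R :=
  let k := ((size v - size u) %/ size w)%N in
  if v == u ++ wpow k then mu ^+ k / W v else 0.

Lemma power_coef_pow u mu k :
  power_coef u mu (u ++ wpow k) = mu ^+ k / W (u ++ wpow k).
Proof. by rewrite /power_coef size_cat addKn size_wpow mulnK// eqxx. Qed.

Lemma power_coef_eq0 u mu v :
  (forall k, v <> u ++ wpow k) -> power_coef u mu v = 0.
Proof. by rewrite /power_coef => h; case: eqP => // /h. Qed.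

Lemma power_coefP u v :
  (exists k, v = u ++ wpow k) \/ (forall k, v <> u ++ wpow k).
Proof.
have [[k ->]|h] := EM (exists k, v = u ++ wpow k); first by left; exists k.
by right=> k e; apply: h; exists k.
Qed.

(** The term of index 0 is split off; the remaining chain is the one that starts at [u ++ w]. *)
Lemma power_coef_rec u mu v :
  power_coef u mu v = (v == u)%:R / W u + mu * power_coef (u ++ w) mu v.
Proof.
have [[[|k] ->]|h] := power_coefP u v.
- rewrite power_coef_pow power_coef_eq0 ?cats0 ?eqxx ?mulr0 ?addr0// => k.
  move=> /(congr1 size)/eqP; rewrite !size_cat -addnA -[eqbLHS]addn0.
  by rewrite eqn_add2l eq_sym addn_eq0 gtn_eqF.
- rewrite power_coef_pow wpowS catA power_coef_pow exprS mulrA.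
  rewrite (_ : _ == u = false) ?mul0r ?add0r//; apply/negbTE/eqP => /(congr1 size)/eqP.
  by rewrite !size_cat -addnA -[eqbRHS]addn0 eqn_add2l addn_eq0 gtn_eqF.
- rewrite !power_coef_eq0// ?mulr0 ?addr0.
    by case: eqP => [vu|_]; [case: (h 0); rewrite cats0|rewrite mul0r].
  by move=> k vk; apply: (h k.+1); rewrite vk wpowS catA.
Qed.

Lemma power_coef_cons i j u mu v :
  lam i v * power_coef (j :: u) mu (i :: v) = (i == j)%:R * power_coef u mu v.
Proof.
have [<-|ij] := eqVneq i j; last first.
  by rewrite power_coef_eq0 ?mulr0 ?mul0r// => k [/eqP]; rewrite (negbTE ij).
rewrite mul1r; have [[k ->]|h] := power_coefP u v.
  rewrite -cat_cons !power_coef_pow [X in _ / X]weight_cons.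
  by field; rewrite !gt_eqF ?weight_gt0.
by rewrite !power_coef_eq0 ?mulr0// => k [/h].
Qed.

Lemma monomial_wpow u k : monomial (u ++ wpow k) = monomial u * monomial w ^+ k.
Proof.
elim: k => [|k IH]; first by rewrite cats0 mulr1.
move: IH; rewrite wpowS /monomial !big_cat/= exprS => /(mulfI _) -> //.
by rewrite gt_eqF//; exact: monomial_gt0.
Qed.

(** The constant in the domination of y_u by [nu]: for [small mu] the powers of [mu] are absorbed by
    those of [monomial w], and what is left does not depend on [mu]. That uniformity allows letting
    [mu] tend to 0. *)
Definition power_bound u : R := (monomial u * Normc.normc (nu [::]))^-1.

Lemma power_bound_ge0 u : 0 <= power_bound u.
Proof. by rewrite invr_ge0 mulr_ge0 ?normc_ge0// ltW// monomial_gt0. Qed.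

Definition small (mu : R) := 0 < mu <= monomial w.

Lemma power_coef_le u mu v : small mu ->
  Normc.normc (power_coef u mu v)%:C <= power_bound u * Normc.normc (nu v).
Proof.
move=> /andP[mu0 mu1]; have [[k ->]|h] := power_coefP u v; last first.
  by rewrite power_coef_eq0// Normc.normc0 mulr_ge0 ?power_bound_ge0 ?normc_ge0.
rewrite power_coef_pow /= expr0n addr0 sqrtr_sqr ger0_norm; last first.
  by rewrite divr_ge0 ?exprn_ge0// ltW ?weight_gt0.
rewrite eigenvector_coord monomial_wpow /power_bound.
have -> : (monomial u * Normc.normc (nu [::]))^-1 *
    (monomial u * monomial w ^+ k / W (u ++ wpow k) * Normc.normc (nu [::])) =
    monomial w ^+ k / W (u ++ wpow k).
  by field; rewrite !gt_eqF ?weight_gt0 ?monomial_gt0 ?eigenvector_nil_gt0.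
by rewrite ler_pM2r ?invr_gt0 ?weight_gt0// lerXn2r ?nnegrE// ltW// monomial_gt0.
Qed.

(* y_u in the header; the junk value 0 unless mu is small. *)
Definition power_vec u mu : H := insubd 0 (fun v => (power_coef u mu v)%:C).

Lemma power_vecE u mu v : small mu -> power_vec u mu v = (power_coef u mu v)%:C.
Proof.
move=> mu_small; rewrite [LHS](_ : _ = (val (power_vec u mu)) v)// insubdK//.
exact: (ell2_dominated (power_bound_ge0 u) (fun v => power_coef_le u v mu_small)).1.
Qed.

Lemma power_vec_norm u mu : small mu ->
  `|power_vec u mu| <= (power_bound u)%:C * `|nu|.
Proof.
move=> mu_small.
apply: (ell2_dominated (power_bound_ge0 u) (fun v => power_coef_le u v mu_small)).2.
by move=> v; rewrite power_vecE.
Qed.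

Lemma power_vec_rec u mu : small mu ->
  power_vec u mu = ((W u)^-1)%:C *: delta u + mu%:C *: power_vec (u ++ w) mu.
Proof.
move=> mu_small; apply/val_inj/funext => v.
rewrite [LHS]power_vecE// power_coef_rec rmorphD !rmorphM rmorph_nat.
congr (_ + _); first by rewrite mulrC.
by congr (_ * _); exact: esym (power_vecE _ _ mu_small).
Qed.

Lemma adjoint_power_vec i j u mu : small mu ->
  B i (power_vec (j :: u) mu) = (i == j)%:R *: power_vec u mu.
Proof.
move=> mu_small; apply/val_inj/funext => v.
rewrite [LHS](adjoint_coord _ _ (T_adj i)) power_vecE// -rmorphM/= power_coef_cons.
by rewrite rmorphM rmorph_nat; congr (_ * _); exact: esym (power_vecE _ _ mu_small).
Qed.

(** The adjoint kills the first term of y_e, which leaves [mu] times the image of y_w; its subscript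
    is nonempty, so the previous rule applies. *)
Lemma adjoint_power_vec_nil i j w' mu : w = j :: w' -> small mu ->
  B i (power_vec [::] mu) = (mu * (i == j)%:R)%:C *: power_vec w' mu.
Proof.
move=> wE mu_small; apply/val_inj/funext => v.
rewrite [LHS](adjoint_coord _ _ (T_adj i)) power_vecE// power_coef_rec mul0r add0r.
rewrite cat0s wE -rmorphM/= mulrCA power_coef_cons mulrA rmorphM/=.
by congr (_ * _); exact: esym (power_vecE _ _ mu_small).
Qed.

Lemma inner_adj i x y : inner (T i x) y = inner x (B i y).
Proof. exact: (T_adj i).2. Qed.

Lemma inner_power_vec x u mu : small mu -> inner x (power_vec u mu) =
  x u / (W u)%:C + mu%:C * inner x (power_vec (u ++ w) mu).
Proof.
move=> mu_small; rewrite power_vec_rec// innerDr !innerZr !conj_realC.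
by rewrite inner_deltar fmorphV mulrC.
Qed.

Lemma small_le0 (z K : R[i]) : 0 <= K ->
  (forall mu, small mu -> `|z| <= mu%:C * K) -> z = 0.
Proof.
move=> K0 zK; apply/eqP; case: (eqVneq z 0) => // z0.
have [k k0 KE] : exists2 k, 0 <= k & K = k%:C.
  by exists (complex.Re K); [rewrite -ler0c|]; rewrite RRe_real// ger0_real.
have nz : 0 < Normc.normc z by exact: normc_gt0.
have k1 : 0 < k + 1 by rewrite ltr_wpDl.
(* This [mu] is admissible and makes [mu * k] at most half the modulus of [z]; the 1 avoids a zero
   divisor when [k] = 0. *)
pose mu := Num.min (monomial w) (Normc.normc z / (2 * (k + 1))).
have mu0 : 0 < mu by rewrite lt_min monomial_gt0 divr_gt0// mulr_gt0.
have := zK mu; rewrite /small mu0 ge_min lexx => /(_ isT).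
rewrite KE -rmorphM lecR.
have : mu * k <= Normc.normc z / (2 * (k + 1)) * k.
  by rewrite ler_wpM2r// ge_min lexx orbT.
move=> h1 h2; have := le_trans h2 h1; rewrite mulrAC ler_pdivlMr ?mulr_gt0//.
by nra.
Qed.

(** Comparison of coefficients in [mu]: after the first terms are split off, their difference is
    [mu] times a quantity bounded uniformly in [mu], hence zero. Dividing by [mu] gives the same
    identity one step further along the chain. *)
Lemma power_vec_step (p q : H) u :
  (forall mu, small mu ->
     inner p (power_vec (u ++ w) mu) = inner q (power_vec u mu)) ->
  p (u ++ w) / (W (u ++ w))%:C = q u / (W u)%:C /\
  forall mu, small mu ->
    inner p (power_vec ((u ++ w) ++ w) mu) = inner q (power_vec (u ++ w) mu).
Proof.
move=> E.
have E' mu : small mu ->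
    p (u ++ w) / (W (u ++ w))%:C - q u / (W u)%:C =
    mu%:C * (inner q (power_vec (u ++ w) mu) - inner p (power_vec ((u ++ w) ++ w) mu)).
  move=> mu_small; have := E mu mu_small.
  rewrite (inner_power_vec p (u ++ w) mu_small) (inner_power_vec q u mu_small) => e.
  by rewrite mulrBr; apply/eqP; rewrite subr_eq addrAC eq_sym subr_eq e addrC.
have pq : p (u ++ w) / (W (u ++ w))%:C = q u / (W u)%:C.
  apply/eqP; rewrite -subr_eq0; apply/eqP.
  apply: (@small_le0 _ (`|q| * ((power_bound (u ++ w))%:C * `|nu|)
                       + `|p| * ((power_bound ((u ++ w) ++ w))%:C * `|nu|))).
    by rewrite addr_ge0// !mulr_ge0// ler0c power_bound_ge0.
  move=> mu mu_small; have /andP[mu0 _] := mu_small.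
  rewrite (E' mu)// normrM ger0_norm ?ler0c ?(ltW mu0)// ler_wpM2l ?ler0c ?(ltW mu0)//.
  rewrite (le_trans (ler_normB _ _))// lerD// (le_trans (Cauchy_Schwarz _ _))//;
    by rewrite ler_wpM2l// power_vec_norm.
split; [exact: pq|move=> mu mu_small; have /andP[mu0 _] := mu_small].
have /eqP := E' mu mu_small; rewrite pq subrr eq_sym mulf_eq0 subr_eq0.
rewrite (negbTE (realC_neq0 mu0)).
by move=> /eqP ->.
Qed.

Definition power_vecs mu : set H :=
  [set power_vec u mu | u in [set u | ~~ suffix w u]].

(** The adjoints map these vectors to multiples of one another: a tail of a word not ending in [w]
    does not end in [w], and the tail of [w], met when [u] is empty, is too short to. *)
Lemma shift_perp_power_vec mu x i : small mu ->
  perp (power_vecs mu) x -> perp (power_vecs mu) (T i x).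
Proof.
move=> mu_small xY.
have xY' u : ~~ suffix w u -> inner x (power_vec u mu) = 0.
  by move=> wu; apply: xY; exists u.
move=> _ [[|j u] /= wu <-]; rewrite inner_adj.
  case wE : {1}w w_gt0 => [|j w'] // _.
  rewrite (adjoint_power_vec_nil i wE)// innerZr xY' ?mulr0//.
  by apply/negP => /size_suffix; rewrite wE ltnn.
rewrite adjoint_power_vec// innerZr xY' ?mulr0//.
by apply: contra wu => wu; exact: suffix_trans wu (suffix_cons _ _).
Qed.

(** The degenerate case [mu] = 0 of the preceding invariance. The complement consists of the vectors
    supported on words ending in [w], and prefixing a letter keeps the ending. *)
Lemma shift_perp_delta x i :
  perp [set delta u | u in [set u | ~~ suffix w u]] x ->
  perp [set delta u | u in [set u | ~~ suffix w u]] (T i x).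
Proof.
move=> xY; have xY' u : ~~ suffix w u -> x u = 0.
  by move=> wu; rewrite -inner_deltar; apply: xY; exists u.
move=> _ [[|j u] /= wu <-]; rewrite inner_adj.
  rewrite (_ : B i _ = 0) ?inner0r//; apply/val_inj/funext => v.
  by rewrite [LHS](adjoint_coord _ _ (T_adj i)) /= mulr0.
rewrite (_ : B i _ = ((i == j)%:R * lam i u)%:C *: delta u).
  rewrite innerZr inner_deltar xY' ?mulr0//.
  by apply: contra wu => wu; exact: suffix_trans wu (suffix_cons _ _).
apply/val_inj/funext => v.
rewrite [LHS](adjoint_coord _ _ (T_adj i)) [RHS]ell2_scaleE.
rewrite !deltaE eqseq_cons.
have [->|_] := eqVneq v u; last by rewrite andbF !mulr0n !mulr0.
by rewrite andbT mulr1n mulr1 rmorphM rmorph_nat mulrC.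
Qed.

(** * The intertwining relation for an operator in Alg Lat *)

Context (A : H -> H) (A_lat : Alg (Lat (wot_algebra (range T))) A).

Lemma range_bounded : range T `<=` @bounded_op R (word n).
Proof. by move=> _ [i _ <-]; exact: (T_shift i).1. Qed.

Lemma image_delta_suffix v : ~~ suffix w v -> A (delta w) v = 0.
Proof.
move=> wv; pose Y : set H := [set delta u | u in [set u | ~~ suffix w u]].
suff : perp Y (A (delta w)) by move=> h; rewrite -inner_deltar; apply: h; exists v.
apply: (Alg_Lat_perp range_bounded _ A_lat).
  by move=> _ [i _ <-] _ [x Yx <-]; exact: shift_perp_delta.
move=> _ [u /= wu <-]; rewrite inner_deltar /=.
by case: eqP wu => // ->; rewrite suffix_refl.
Qed.

(** In the formal notation [p] is A R_w xi_e and [q] is A xi_e, so the aim is p = R_w q. *)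
Let p := A ((W w)%:C *: delta w).
Let q := A (delta [::]).

Lemma inner_image_power_vec mu u : small mu -> ~~ suffix w u ->
  inner p (power_vec u mu) = mu%:C * inner q (power_vec u mu).
Proof.
move=> mu_small wu.
have linA := A_lat.1.1.
suff : perp (power_vecs mu) (A ((- mu%:C) *: delta [::] + (W w)%:C *: delta w)).
  move=> /(_ (power_vec u mu)); rewrite linA innerDl innerZl -/p -/q mulNr addrC.
  by move=> h; apply/eqP; rewrite -subr_eq0 h//; exists u.
apply: (Alg_Lat_perp range_bounded _ A_lat).
  by move=> _ [i _ <-] _ [x Yx <-]; exact: shift_perp_power_vec.
move=> _ [v /= wv <-]; rewrite innerDl !innerZl !inner_deltal !power_vecE// !conj_realC.
case: v wv => [|i v] wv.
  have h0 : power_coef [::] mu [::] = 1.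
    by rewrite (power_coef_pow [::] mu 0) expr0 divr1.
  have h1 : power_coef [::] mu w = mu / W w.
    by have := power_coef_pow [::] mu 1; rewrite /= cats0 expr1.
  rewrite h0 h1 mulr1 -rmorphM/= mulrC divfK ?gt_eqF ?weight_gt0// ?addNr//.
(* For nonempty [v] neither the empty word nor [w] lies on the chain of [v]: power 0 would give [v]
   = [w], which ends in [w], and higher powers are too long. *)
rewrite !power_coef_eq0 ?mulr0 ?addr0// => -[|k].
  by rewrite cats0 => wE; rewrite -wE suffix_refl in wv.
by move=> /(congr1 size)/eqP; rewrite wpowS !size_cat addnCA -[eqbLHS]addn0 eqn_add2l.
Qed.

(** Induction on the length of [u]. If [u] ends in [w], [power_vec_step] climbs from the shorter
    word. Otherwise [p u] = 0, the recursion for y_u leaves a factor [mu] on both sides, and it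
    cancels. *)
Lemma inner_image_all u mu : small mu ->
  inner p (power_vec (u ++ w) mu) = inner q (power_vec u mu).
Proof.
have [m] := ubnP (size u).
elim: m u mu => [u mu|m IH u mu um mu_small]; first by rewrite ltn0 => /notF[].
have [/suffixP[u' uE]|wu] := boolP (suffix w u).
  rewrite uE; apply: (power_vec_step _).2 mu_small => mu' mu'_small; apply: IH mu'_small.
  move: um; rewrite uE size_cat ltnS; apply: leq_trans.
  by rewrite -[ltnLHS]addn0 ltn_add2l.
have /andP[mu0 _] := mu_small.
have := inner_image_power_vec mu_small wu.
rewrite (inner_power_vec p u mu_small) [p u](_ : _ = 0); last first.
  by rewrite /p (linearZ_bounded _ _ A_lat.1) [LHS]ell2_scaleE image_delta_suffix// mulr0.
rewrite mul0r add0r => /mulfI; apply.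
exact: realC_neq0.
Qed.

(** The relation p = R_w q, read off at the coordinate [u ++ w]. *)
Lemma image_delta u :
  A (delta w) (u ++ w) * (W w)%:C / (W (u ++ w))%:C = A (delta [::]) u / (W u)%:C.
Proof.
have [<- _] := power_vec_step (fun mu => @inner_image_all u mu).
by congr (_ / _); rewrite mulrC /p (linearZ_bounded _ _ A_lat.1).
Qed.

End PowerVectors.

End Shift.

(** * Extending bounds and convergence from finite combinations *)

Section WeakConvergence.
Context {R : realType} {I : choiceType}.
Local Notation H := (ell2 R I).
Implicit Types (A B : H -> H) (x y : H) (c : R[i]).

Lemma bounded_op0 B : bounded_op B -> B 0 = 0.
Proof. by move=> bB; have := linearZ_bounded 0 0 bB; rewrite !scale0r. Qed.

Lemma bounded_op_sum B (J : finType) (a : J -> R[i]) (F : J -> H) : bounded_op B ->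
  B (\sum_j a j *: F j) = \sum_j a j *: B (F j).
Proof.
move=> bB; have linB := bB.1; apply: (big_rec2 (fun x y => B x = y)).
  exact: bounded_op0.
by move=> j y _ _ <-; rewrite linB.
Qed.

Lemma op_inner_comb (J : finType) (e : J -> I) B (a b : J -> R[i]) :
  bounded_op B -> inner (B (comb e a)) (comb e b) =
  \sum_s \sum_t a s * (b t)^* * B (delta (e s)) (e t).
Proof.
move=> bB; rewrite /comb bounded_op_sum// inner_suml; apply: eq_bigr => s _.
rewrite innerZl inner_sumr mulr_sumr; apply: eq_bigr => t _.
by rewrite innerZr inner_deltar mulrA.
Qed.

Lemma finite_approx2 x y c : 0 < c ->
  exists (J : finType) (e : J -> I), [/\ injective e,
    `|x - comb e (x \o e)| < c & `|y - comb e (y \o e)| < c].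
Proof.
move=> c0; have [k k0 ->] := gt0_realC c0.
have [X HX] := finite_approx x k0; have [Y HY] := finite_approx y k0.
exists (seq_sub (X ++ Y)), val; split; first exact: val_inj.
- apply: HX => [|i iX]; first exact: val_inj.
  have iXY : i \in X ++ Y by rewrite mem_cat iX.
  by apply/codomP; exists (SeqSub iXY).
- apply: HY => [|i iY]; first exact: val_inj.
  have iXY : i \in X ++ Y by rewrite mem_cat iY orbT.
  by apply/codomP; exists (SeqSub iXY).
Qed.

Lemma norm_comb_le (J : finType) (e : J -> I) x : injective e ->
  `|comb e (x \o e)| <= `|x|.
Proof.
by move=> e_inj; rewrite -ler_sqr ?nnegrE// sqr_norm_comb//; exact: Bessel.
Qed.

Lemma inner_op_split B x y x' y' : bounded_op B ->
  inner (B x) y = inner (B x') y' + (inner (B (x - x')) y + inner (B x') (y - y')).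
Proof.
move=> bB; have BB : B (x - x') = B x - B x'.
  by rewrite addrC -scaleN1r bB.1 scaleN1r addrC.
by rewrite BB innerBl innerBr; ring.
Qed.

(** Density of the finite combinations. The bound is by a sum of squares, not a product, because
    squared norms add up over windows of words. *)
Lemma form_bound_ext B c : bounded_op B -> 0 <= c ->
  (forall (J : finType) (e : J -> I) (a b : J -> R[i]), injective e ->
    `|inner (B (comb e a)) (comb e b)| <= c * (`|comb e a| ^+ 2 + `|comb e b| ^+ 2)) ->
  forall x y, `|inner (B x) y| <= c * (`|x| ^+ 2 + `|y| ^+ 2).
Proof.
move=> bB c0 Bc x y; have [k k0 Bk] := bounded_opP bB.
apply/ler_addgt0Pr => d d0.
(* The two error terms add up to at most [(M - 1) * (d / M)]; the 1 makes [M] positive. *)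
pose M := k * (`|x| + `|y|) + 1.
have M0 : 0 < M by rewrite ltr_wpDl// mulr_ge0// addr_ge0.
have [J [e [e_inj xe ye]]] := finite_approx2 x y (divr_gt0 d0 M0).
set x' := comb e _ in xe; set y' := comb e _ in ye.
rewrite (inner_op_split x y x' y' bB) (le_trans (ler_normD _ _))// lerD//.
  rewrite (le_trans (Bc _ _ _ _ e_inj))// ler_wpM2l// lerD// lerXn2r ?nnegrE//;
    exact: norm_comb_le.
rewrite (le_trans (ler_normD _ _))//.
apply: (@le_trans _ _ (k * (d / M) * `|y| + k * `|x| * (d / M))).
  apply: lerD; rewrite (le_trans (Cauchy_Schwarz _ _))// ler_pM//.
  - by rewrite (le_trans (Bk _))// ler_wpM2l// ltW.
  - by rewrite (le_trans (Bk _))// ler_wpM2l// norm_comb_le.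
  - by rewrite ltW.
rewrite (_ : _ + _ = (M - 1) * (d / M)); last by rewrite /M; ring.
by rewrite mulrA ler_pdivrMr// mulrC ler_wpM2l ?(ltW d0)// gerBl.
Qed.

(** After normalizing [x] and [y] the sum of squares is 2, whence the factor 2. *)
Lemma form_bound_homogeneous B c : bounded_op B ->
  (forall x y, `|inner (B x) y| <= c * (`|x| ^+ 2 + `|y| ^+ 2)) ->
  forall x y, `|inner (B x) y| <= c * 2 * (`|x| * `|y|).
Proof.
move=> bB Bc x y.
have [->|x0] := eqVneq x 0.
  by rewrite (bounded_op0 bB) inner0l !normr0 mul0r mulr0.
have [->|y0] := eqVneq y 0; first by rewrite inner0r !normr0 !mulr0.
have nx : 0 < `|x| by rewrite normr_gt0.
have ny : 0 < `|y| by rewrite normr_gt0.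
have := Bc (`|x|^-1 *: x) (`|y|^-1 *: y).
rewrite (linearZ_bounded _ _ bB) innerZl innerZr !normrM norm_conjC !normrZ.
rewrite !normfV !normr_id !mulVf ?gt_eqF// expr1n mulrA -invfM.
by rewrite ler_pdivrMl ?mulr_gt0// mulrC.
Qed.

(** Convergence of matrix entries settles finite combinations, and the common bound [K] makes the
    truncation error independent of the index. *)
Lemma weak_cvg (B_ : nat -> H -> H) A (K : R[i]) : 0 <= K ->
  bounded_op A -> (forall k, bounded_op (B_ k)) ->
  (forall k x y, `|inner (B_ k x) y| <= K * (`|x| * `|y|)) ->
  (forall i j, (fun k => B_ k (delta i) j : R[i]^o) @ \oo --> (A (delta i) j : R[i]^o)) ->
  forall x y,
    (fun k => inner (B_ k x) y : R[i]^o) @ \oo --> (inner (A x) y : R[i]^o).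
Proof.
move=> K0 bA bB BK Bdelta x y.
have [c c0 Ac] := bounded_opP bA.
have AK u v : `|inner (A u) v| <= c * (`|u| * `|v|).
  by rewrite (le_trans (Cauchy_Schwarz _ _))// mulrA ler_wpM2r.
apply/cvgrPdist_lt => d d0.
pose M := (K + c) * (`|x| + `|y|) + 1.
have M0 : 0 < M by rewrite ltr_wpDl// mulr_ge0 ?addr_ge0.
have d2 : 0 < d / 2 by rewrite divr_gt0.
have [J [e [e_inj xe ye]]] := finite_approx2 x y (divr_gt0 d2 M0).
set x' := comb e _ in xe; set y' := comb e _ in ye.
have x'x : `|x'| <= `|x| by exact: norm_comb_le.
have cvg' : (fun k => inner (B_ k x') y' : R[i]^o) @ \oo --> (inner (A x') y' : R[i]^o).
  rewrite op_inner_comb//; under eq_fun do rewrite op_inner_comb//.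
  apply: (cvg_big (@add_continuous R[i]^o)) => s _.
  apply: (cvg_big (@add_continuous R[i]^o)) => t _.
  by apply: cvgMl_tmp; exact: Bdelta.
have near' : \forall k \near \oo, `|inner (A x') y' - inner (B_ k x') y'| < d / 2.
  by move/cvgrPdist_lt : cvg' => /(_ _ d2).
have bound (D : H -> H) (k : R[i]) : 0 <= k ->
    (forall u v, `|inner (D u) v| <= k * (`|u| * `|v|)) ->
    `|inner (D (x - x')) y + inner (D x') (y - y')| <=
      k * (`|x| + `|y|) * (d / 2 / M).
  move=> k0 Dk; rewrite (le_trans (ler_normD _ _))//.
  rewrite (_ : _ * _ = k * (d / 2 / M * `|y|) + k * (`|x| * (d / 2 / M))); last by ring.
  apply: lerD; rewrite (le_trans (Dk _ _))// ler_wpM2l//.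
  - by rewrite ler_wpM2r// ltW.
  - by rewrite ler_pM// ltW.
near=> k.
rewrite (inner_op_split x y x' y' bA) (inner_op_split x y x' y' (bB k)).
rewrite opprD addrACA (splitr d).
apply: le_lt_trans (ler_normD _ _) _; apply: ltr_leD; first by near: k.
rewrite (le_trans (ler_normB _ _))//.
apply: (le_trans (lerD (bound _ _ c0 AK) (bound _ _ K0 (BK k)))).
rewrite -!mulrDl (addrC c) (_ : (K + c) * _ = M - 1); last by rewrite /M; ring.
by rewrite mulrA ler_pdivrMr// mulrC ler_wpM2l ?(ltW d2)// gerBl.
Unshelve. all: by end_near. Qed.

End WeakConvergence.

Lemma cat_injl (T : eqType) (s : seq T) : injective (cat^~ s).
Proof.
move=> s1 s2 /eqP; rewrite -(inj_eq (can_inj revK)) !rev_cat eqseq_cat// eqxx.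
by rewrite (inj_eq (can_inj revK)) => /eqP.
Qed.

Lemma sum_nat_interval (M a b : nat) :
  (\sum_(m < M) (a <= m < b) = minn M b - a)%N.
Proof.
elim: M => [|M IH]; first by rewrite big_ord0 min0n.
by rewrite big_ord_recr/= IH; lia.
Qed.

Lemma norm_mul_le (R : realType) (I : choiceType) (x y : ell2 R I) :
  `|x| * `|y| <= `|x| ^+ 2 + `|y| ^+ 2.
Proof.
rewrite -[`|x|]/((ell2_norm x)%:C) -[`|y|]/((ell2_norm y)%:C).
rewrite -!rmorphXn -rmorphM -rmorphD lecR.
have := ell2_norm_ge0 x; have := ell2_norm_ge0 y; nra.
Qed.

(** * Windows of N + 1 consecutive word lengths *)

Section Windows.
Context {R : realType} {n : nat}.
Implicit Types (u v w : word n).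

(** Indicator of the lengths from [m - N] to [m], written so that no truncated subtraction
    occurs. *)
Definition window N m u : R[i] := (size u <= m < size u + N.+1)%N%:R.

Lemma window_conj N m u : (window N m u)^* = window N m u.
Proof. by rewrite /window rmorph_nat. Qed.

(** Both words are seen exactly for [m] from [size v] to [size u + N], and [M] is large enough to
    lose none of these. *)
Lemma window_sum N M u v : (size u <= size v)%N -> (size v + N.+1 <= M)%N ->
  \sum_(m < M) window N m u * window N m v = (N.+1 - (size v - size u))%:R.
Proof.
move=> uv vM.
rewrite (eq_bigr (fun m : 'I_M => (size v <= m < size u + N.+1)%N%:R)) => [|m _].
  by rewrite -natr_sum sum_nat_interval; congr _%:R; lia.
rewrite /window -natrM mulnb; congr (nat_of_bool _)%:R; lia.
Qed.

Lemma sqr_norm_window N m u (z : R[i]) :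
  `|window N m u * z| ^+ 2 = window N m u * window N m u * `|z| ^+ 2.
Proof. by rewrite normrM exprMn /window normr_nat. Qed.

(** Each coordinate survives in exactly N + 1 windows, by the preceding count with both words
    equal. *)
Lemma sum_sqr_norm_window (J : finType) (e : J -> word n) N M (a : J -> R[i]) :
  injective e -> (forall j, (size (e j) + N.+1 <= M)%N) ->
  \sum_(m < M) `|comb e (fun j => window N m (e j) * a j)| ^+ 2 =
  N.+1%:R * `|comb e a| ^+ 2.
Proof.
move=> e_inj eM; under eq_bigr do rewrite sqr_norm_comb//.
rewrite sqr_norm_comb// exchange_big mulr_sumr; apply: eq_bigr => j _ /=.
under eq_bigr do rewrite sqr_norm_window.
by rewrite -mulr_suml window_sum// subnn subn0.
Qed.

End Windows.

(** * Fejer means and their convergence *)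

Section Cesaro.
Context {R : realType} {n : nat} (lam : 'I_n -> word n -> R).
Context (lam_gt0 : forall i w, 0 < lam i w).
Context (T : 'I_n -> ell2 R (word n) -> ell2 R (word n)).
Context (T_shift : weighted_shift lam T).
Local Notation H := (ell2 R (word n)).
Local Notation W := (weight lam [::]).
Implicit Types (u v w : word n).

Definition shift_word u : H -> H := foldr (fun i F => T i \o F) idfun u.

Lemma shift_word_delta u w :
  shift_word u (delta w) = (W (u ++ w) / W w)%:C *: delta (u ++ w).
Proof.
elim: u => [|i u IH].
  by rewrite /= divff ?gt_eqF ?weight_gt0// scale1r.
transitivity (T i (shift_word u (delta w))); first by [].
rewrite IH.
rewrite (linearZ_bounded _ _ (T_shift i).1) (T_shift i).2 scalerA -rmorphM.
by congr (_%:C *: _); rewrite cat_cons (weight_cons lam i (u ++ w)); ring.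
Qed.

Lemma algebra_sum (S : set (H -> H)) (J : finType) (c : J -> R[i]) (F : J -> H -> H) :
  unital_op_algebra S -> (forall j, S (F j)) -> S (\sum_j c j *: F j).
Proof.
move=> [_ S1 Slin _] SF; apply: big_ind => [|F1 F2 S1' S2|j _].
- by have := Slin (-1) _ _ S1 S1; rewrite scaleN1r addNr.
- by rewrite -[F1]scale1r; exact: Slin.
- have S0 : S 0 by have := Slin (-1) _ _ S1 S1; rewrite scaleN1r addNr.
  by rewrite -[_ *: _]addr0; exact: Slin.
Qed.

Lemma algebra_shift_word (S : set (H -> H)) u :
  unital_op_algebra S -> (forall i, S (T i)) -> S (shift_word u).
Proof.
by move=> [_ S1 _ Scomp] ST; elim: u => //= i u IH; apply: Scomp.
Qed.

Context (A : H -> H) (A_bounded : bounded_op A).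
Context (A_suffix : forall w v, ~~ suffix w v -> A (delta w) v = 0).
Context (A_image : forall w u, A (delta w) (u ++ w) * (W w)%:C / (W (u ++ w))%:C
  = A (delta [::]) u / (W u)%:C).

(** The Fejer coefficient 1 - d / (N + 1); subtraction in [nat] makes it 0 for d > N. *)
Definition fejer (N : nat) (d : nat) : R := (N.+1 - d)%:R / N.+1%:R.

(** Words of length N + 1 are summed too, but with weight 0. *)
Definition cesaro (N : nat) : H -> H := \sum_(u : N.+1.-bseq 'I_n)
  ((fejer N (size u))%:C * (A (delta [::]) u / (W u)%:C)) *: shift_word u.

Lemma algebra_cesaro (S : set (H -> H)) N :
  unital_op_algebra S -> (forall i, S (T i)) -> S (cesaro N).
Proof.
by move=> aS ST; apply: algebra_sum => // u; exact: algebra_shift_word.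
Qed.

Lemma cesaro_bounded N : bounded_op (cesaro N).
Proof.
by apply: algebra_cesaro => [|i]; [exact: bounded_op_algebra|exact: (T_shift i).1].
Qed.

(** At most one word [u] satisfies [v = u ++ w], and by [A_image] its Fourier coefficient times the
    weight ratio is the entry of [A]. The mean thus multiplies matrix entries by Fejer weights. *)
Lemma cesaro_delta N w v :
  cesaro N (delta w) v = (fejer N (size v - size w))%:C * A (delta w) v.
Proof.
have E : cesaro N (delta w) v = \sum_(u : N.+1.-bseq 'I_n)
    ((fejer N (size u))%:C * (A (delta [::]) u / (W u)%:C)) *
    ((W (u ++ w) / W w)%:C * (v == u ++ w)%:R).
  rewrite /cesaro fct_sumE -inner_deltar inner_suml; apply: eq_bigr => u _.
  by rewrite innerZl shift_word_delta innerZl inner_deltar.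
rewrite {}E; have [/suffixP[u ->]|wv] := boolP (suffix w v); last first.
  rewrite A_suffix// mulr0 big1// => u _.
  case: eqP => [vE|_]; last by rewrite mulr0n !mulr0.
  by rewrite vE suffix_suffix in wv.
rewrite size_cat addnK; have [uN|uN] := leqP (size u) N.+1; last first.
  rewrite big1 => [|t _].
    have -> : fejer N (size u) = 0 by rewrite /fejer (eqP (ltnW uN)) mul0r.
    by rewrite mul0r.
  case: eqP => [/cat_injl ut|_]; last by rewrite mulr0n !mulr0.
  by rewrite ut ltnNge size_bseq in uN.
rewrite (bigD1 (Bseq uN))//= eqxx mulr1n mulr1 big1 ?addr0 => [|t tu]; last first.
  case: eqP => [/cat_injl ut|_]; last by rewrite mulr0n !mulr0.
  by case/negP: tu; apply/eqP/val_inj.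
rewrite -(A_image w) -mulrA; congr (_ * _).
rewrite rmorphM fmorphV/=.
by field; rewrite !realC_neq0 ?weight_gt0.
Qed.

(* Two words lie in a common window of N + 1 consecutive lengths for exactly
   N + 1 minus the difference of their lengths positions of the window, so a
   Fejer mean of A is an average of compressions of A. *)
Lemma cesaro_comb (J : finType) (e : J -> word n) N M (a b : J -> R[i]) :
  (forall j, (size (e j) + N.+1 <= M)%N) ->
  N.+1%:R * inner (cesaro N (comb e a)) (comb e b) =
  \sum_(m < M) inner (A (comb e (fun j => window N m (e j) * a j)))
                     (comb e (fun j => window N m (e j) * b j)).
Proof.
move=> eM; under eq_bigr do rewrite op_inner_comb//.
rewrite op_inner_comb; last exact: cesaro_bounded.
rewrite [RHS]exchange_big mulr_sumr; apply: eq_bigr => s _.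
rewrite [RHS]exchange_big mulr_sumr; apply: eq_bigr => t _.
rewrite cesaro_delta.
under eq_bigr => m _.
  rewrite rmorphM/= window_conj.
  rewrite (_ : _ * _ = window N m (e s) * window N m (e t) *
     (a s * (b t)^* * A (delta (e s)) (e t))); last by ring.
  over.
rewrite -mulr_suml; have [st|st] := boolP (suffix (e s) (e t)); last first.
  by rewrite A_suffix// !mulr0.
rewrite window_sum ?size_suffix// /fejer rmorphM fmorphV !rmorph_nat.
have : N.+1%:R != 0 :> R[i] by rewrite pnatr_eq0.
by move: N.+1%:R (_ - _)%N%:R => k d k0; field.
Qed.

(** Each compression obeys the bound [c] of [A]; summed over the windows the squared norms grow by N
    + 1, which the averaging removes. *)
Lemma cesaro_bound : exists2 K : R[i], 0 <= K & forall N x y,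
  `|inner (cesaro N x) y| <= K * (`|x| * `|y|).
Proof.
have [c c0 Ac] := bounded_opP A_bounded.
exists (c * 2); first by rewrite mulr_ge0.
move=> N; apply: form_bound_homogeneous; first exact: cesaro_bounded.
apply: form_bound_ext => //; first exact: cesaro_bounded.
move=> J e a b e_inj.
pose M := (\max_j size (e j) + N.+1)%N.
have eM j : (size (e j) + N.+1 <= M)%N by rewrite leq_add2r leq_bigmax.
have N0 : 0 < N.+1%:R :> R[i] by rewrite ltr0n.
rewrite -(ler_pM2l N0) -[X in X * _](ger0_norm (ltW N0)) -normrM (cesaro_comb _ _ eM).
rewrite mulrCA mulrDr -!(sum_sqr_norm_window _ e_inj eM) -big_split/= mulr_sumr.
apply: le_trans (ler_norm_sum _ _ _) _; apply: ler_sum => m _.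
apply: le_trans (Cauchy_Schwarz _ _) _.
apply: (le_trans (ler_wpM2r _ (Ac _))) => //; rewrite -mulrA ler_wpM2l//.
exact: norm_mul_le.
Qed.

Lemma cvg_fejer d : (fun N => (fejer N d)%:C : R[i]^o) @ \oo --> (1 : R[i]^o).
Proof.
apply/cvgrPdist_lt => k k0.
have [r r0 ->] := gt0_realC k0.
(* [d.+1] instead of [d] avoids dividing by zero when [d] = 0. *)
have d0 : 0 < r / d.+1%:R by rewrite divr_gt0.
near=> N.
have N1 : N.+1%:R^-1 < r / d.+1%:R by near: N; exact: (near_infty_natSinv_lt (PosNum d0)).
have dN : (d <= N.+1)%N by near: N; exists d => // m /= dm; rewrite ltnW.
have -> : (1 : R[i]) - (fejer N d)%:C = (d%:R / N.+1%:R)%:C.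
  rewrite /fejer natrB// !rmorphM !fmorphV rmorphB !rmorph_nat.
  have : N.+1%:R != 0 :> R[i] by rewrite pnatr_eq0.
  by move: N.+1%:R d%:R => k' d' k0'; field.
rewrite ger0_norm; last by rewrite ler0c divr_ge0.
rewrite ltcR; apply: (@le_lt_trans _ _ (d.+1%:R / N.+1%:R)).
  by rewrite ler_wpM2r ?invr_ge0// ler_nat.
by rewrite mulrC -ltr_pdivlMr.
Unshelve. all: by end_near. Qed.

Lemma analytic_mem (S : set (H -> H)) : unital_op_algebra S -> wot_closed S ->
  (forall i, S (T i)) -> S A.
Proof.
move=> aS cS ST; have [K K0 CK] := cesaro_bound.
apply: (wot_closed_lim cS A_bounded (fun N => algebra_cesaro N aS ST)).
apply: (weak_cvg K0 A_bounded cesaro_bounded CK) => w v.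
under eq_fun do rewrite cesaro_delta.
have := cvgMr_tmp (b := A (delta w) v : R[i]^o) (cvg_fejer (size v - size w)).
by rewrite mul1r; apply.
Qed.

End Cesaro.

(** * From an open set of eigenvalues to reflexivity *)

Lemma open_nonzero_coords (K : numFieldType) (n : nat) (U : set 'rV[K^o]_n) :
  open U -> U !=set0 -> exists2 l, U l & forall i, l 0 i != 0.
Proof.
move=> oU [l0 Ul0].
have /nbhs_ballP[e /= e0 eU] : nbhs l0 U by exact: open_nbhs_nbhs.
(* Zero coordinates are moved by half the radius of a ball inside [U]. The domination of y_u
   requires all eigenvalues to be nonzero. *)
exists (\row_i if l0 0 i == 0 then e / 2 else l0 0 i); last first.
  by move=> i; rewrite mxE; case: ifPn => // _; rewrite gt_eqF// divr_gt0.
apply: eU; split=> // i j; rewrite ord1 mxE.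
case: ifPn => [/eqP ->|_]; last exact: ballxx.
by rewrite /ball/= sub0r normrN ger0_norm ?divr_ge0 ?ltW// gtr_pMr// invf_lt1// ltr1n.
Qed.

Theorem theorem3p1 (R : realType) (n : nat) (n_ge2 : (2 <= n)%N)
    (lam : 'I_n -> word n -> R) (lam_gt0 : forall i w, 0 < lam i w)
    (T : 'I_n -> ell2 R (word n) -> ell2 R (word n))
    (T_shift : weighted_shift lam T)
    (W_bounded : (ereal_sup [set (weight lam [:: p.1] p.2 / weight lam [::] p.2)%:E
                            | p in [set: 'I_n * word n]] < +oo)%E)
    (U : set 'rV[R[i]^o]_n) (U_open : open U) (U_neq0 : U !=set0)
    (U_eig : U `<=` adjoint_eigenvalues T) :
  reflexive_algebra (wot_algebra (range T)).
Proof.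
apply/seteqP; split.
  by apply: sub_Alg_Lat => _ [i _ <-]; exact: (T_shift i).1.
(* Membership in [wot_algebra] is tested on an arbitrary WOT-closed unital algebra [S] containing
   the [T i]. *)
move=> A A_lat S [[aS cS] TS].
have [l Ul l_neq0] := open_nonzero_coords U_open U_neq0.
have [nu nu_neq0 nu_eig] := U_eig _ Ul.
pose B i := sval (cid2 (nu_eig i)).
have T_adj i : is_adjoint (T i) (B i) by rewrite /B; case: cid2.
have B_nu i : B i nu = l 0 i *: nu by rewrite /B; case: cid2.
apply: (analytic_mem lam_gt0 T_shift A_lat.1) aS cS _ => [w v|w u|i].
- exact: (image_delta_suffix T_shift T_adj A_lat).
(* For the empty word the relation is trivial; the power vectors require a nonempty one. *)
- have [w0|w_gt0] := posnP (size w).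
    by rewrite (size0nil w0) cats0 mulr1.
  exact: (image_delta lam_gt0 T_shift l_neq0 nu_neq0 T_adj B_nu w_gt0 A_lat).
- by apply: TS; exists i.
Qed.
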